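(* Let $k\in\mathbb{N}$ and let $(G_n)_{n\in\mathbb{N}}$ be a sequence of finitely generated groups equipped with finite generating sets $S_n$ of size $k$. Assume that for every $n$ there is an exact sequence $1\to N_n\to G_n\to Q_n\to 1$ such that: (i) the sequence $(N_n)_{n\in\mathbb{N}}$, equipped with the metrics induced from $(G_n,d_{S_n})$, coarsely embeds into a Hilbert space; (ii) the sequence $(Q_n)_{n\in\mathbb{N}}$, equipped with the word metrics associated to the projections $T_n$ of $S_n$ to $Q_n$, coarsely embeds into a Hilbert space. Then, given a number $K>0$, an expander $(X_n)_{n\in\mathbb{N}}$, and a sequence of $K$-Lipschitz maps $h_n\colon X_n\to Y_n=(G_n,S_n)$, there exist a constant $c>0$ and a sequence $y_n\in Y_n$ such that for all $n$ the cardinality of $h_n^{-1}(\{y_n\})$ is at least $c|X_n|$ and its diameter (in $X_n$) is at least $c\,\mathrm{diam}(X_n)$.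
   Context: $(G_n,S_n)$ denotes the Cayley graph of $G_n$ with its word metric $d_{S_n}$; graphs are regarded as metric spaces (vertex sets with the graph metric). Coarse embedding: a sequence of maps $\phi_n\colon X_n\to Y$ from metric spaces $(X_n,d_n)$ to a metric space $(Y,d_Y)$ is a coarse embedding of $(X_n)$ into $Y$ if there are two proper functions $\rho,\gamma\colon[0,\infty)\to[0,\infty)$ (independent of $n$) with $\rho(d_n(x,y))\leqslant d_Y(\phi_n(x),\phi_n(y))\leqslant\gamma(d_n(x,y))$ for all $n$ and all $x,y\in X_n$. Expander: for a finite connected graph $X$ and a set $A$ of vertices, $\partial A$ is the set of edges between $A$ and $X\setminus A$, and $h(X)=\min_{1\leqslant|A|\leqslant|X|/2}|\partial A|/|A|$. An expander is a sequence $(X_n)$ of finite connected graphs with uniformly bounded degree, $|X_n|\to\infty$, and $h(X_n)\geqslant c_0$ for all $n$ for some constant $c_0>0$.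
   Formalization: The diameter bound is claimed only for all but finitely many n (the cardinality bound for all n, with the same c and y_n); for all n it fails, e.g. if X_0 is a single edge mapped injectively to Z/2, where every fibre has diameter 0. *)

(* Defs.v *)
From HB Require Import structures.
From mathcomp Require Import all_boot all_order all_algebra.
From mathcomp Require Import all_classical all_reals all_analysis.
From mathcomp Require Import sesquilinear.
Import Order.TTheory GRing.Theory Num.Theory.
Import numFieldNormedType.Exports.

Set Implicit Arguments.
Unset Strict Implicit.
Unset Printing Implicit Defensive.

Local Open Scope classical_set_scope.
Local Open Scope ring_scope.

(* Least element of a set of naturals; 0 on the empty set, which never occurs
   below for generating sets and connected graphs. *)
Definition least (P : set nat) : nat :=
  if pselect (exists n, `[< P n >]) is left exP then ex_minn exP else 0%N.

Section Groups.
Local Open Scope group_scope.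
Variables (G Q : groupType).

(* [g] is a product of [l] letters from S and its inverses. *)
Definition is_word (S : set G) (l : nat) (g : G) : Prop :=
  exists w : 'I_l -> G,
    (forall i, S (w i) \/ S (w i)^-1) /\ g = \prod_(i < l) w i.

Definition generates (S : set G) : Prop := forall g, exists l, is_word S l g.

Definition word_length (S : set G) (g : G) : nat :=
  least [set l | is_word S l g].

Definition word_dist (S : set G) (x y : G) : nat := word_length S (x^-1 * y).

Definition short_exact (N : groupType) (iota : {multiplicative N -> G})
    (pi : {multiplicative G -> Q}) : Prop :=
  [/\ injective iota, range iota = [set g | pi g = 1] & range pi = setT].

End Groups.

Section CoarseEmbedding.
Variable R : realType.

(* Properness of a map [0, oo[ -> [0, oo[ : preimages of bounded sets are
   bounded. Only the values of [f] on [0, oo[ matter. *)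
Definition proper_fun (f : R -> R) : Prop :=
  (forall t, 0 <= t -> 0 <= f t) /\
  (forall B : set R, bounded_set B -> bounded_set [set t | 0 <= t /\ B (f t)]).

Definition coarse_embedding (X : nat -> Type) (d : forall n, X n -> X n -> R)
    (Y : Type) (dY : Y -> Y -> R) (phi : forall n, X n -> Y) : Prop :=
  exists rho gamma : R -> R, [/\ proper_fun rho, proper_fun gamma &
    forall n (x y : X n),
      rho (d n x y) <= dY (phi n x) (phi n y) <= gamma (d n x y)].

(* The norm of the Banach space H comes from an inner product. Complex Hilbert
   spaces are covered through their underlying real Hilbert space. *)
Definition is_hilbert (H : completeNormedModType R) : Prop :=
  exists dot : {dot H for idfun}, forall x : H, `|x| ^+ 2 = dot x x.

Definition coarsely_embeds_hilbert (X : nat -> Type)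
    (d : forall n, X n -> X n -> R) : Prop :=
  exists H : completeNormedModType R, is_hilbert H /\
    exists phi : forall n, X n -> H,
      coarse_embedding d (fun u v : H => `|u - v|) phi.

End CoarseEmbedding.

Record sgraph := SGraph {
  vertex :> finType;
  adj : rel vertex;
  adj_sym : symmetric adj;
  adj_irrefl : irreflexive adj }.

Section Graphs.
Variable X : sgraph.

Definition connected_graph : Prop :=
  (0 < #|X|)%N /\ forall x y : X, connect (@adj X) x y.

Definition graph_dist (x y : X) : nat :=
  least [set l | exists p : seq X,
    [/\ path (@adj X) x p, last x p = y & size p = l]].

Definition diam (A : {set X}) : nat :=
  (\max_(x in A) \max_(y in A) graph_dist x y)%N.

(* An edge between A and its complement is listed once, as the ordered pair
   whose first component is its endpoint in A. *)
Definition edge_boundary (A : {set X}) : {set X * X} :=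
  [set e | [&& e.1 \in A, e.2 \notin A & adj e.1 e.2]]%SET.

(* Extended-real-valued so that the minimum over the empty family (|X| <= 1)
   is +oo. *)
Definition cheeger (R : realType) : \bar R :=
  \big[Order.min/+oo%E]_(A : {set X} | (0 < #|A|)%N && (#|A|.*2 <= #|X|)%N)
    (#|edge_boundary A|%:R / #|A|%:R)%:E.

End Graphs.

Definition expander (R : realType) (X : nat -> sgraph) : Prop :=
  [/\ forall n, connected_graph (X n),
      exists D : nat, forall n (x : X n), (#|[set y | adj x y]%SET| <= D)%N,
      #|X n| @[n --> \oo] --> \oo &
      exists2 c0 : R, 0 < c0 & forall n, (c0%:E <= cheeger (X n) R)%E].

Definition fibre (X : finType) (Y : Type) (h : X -> Y) (y : Y) : {set X} :=
  [set x | `[< h x = y >]]%SET.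

(* Main.v *)
Require Import Defs.
From HB Require Import structures.
From mathcomp Require Import all_boot all_order all_algebra.
From mathcomp Require Import all_classical all_reals all_analysis.
From mathcomp Require Import sesquilinear ring lra zify.
Import Order.TTheory GRing.Theory Num.Theory.
Import numFieldNormedType.Exports.
Set Implicit Arguments.
Unset Strict Implicit.
Unset Printing Implicit Defensive.
Local Open Scope classical_set_scope.
Local Open Scope ring_scope.

(** An expander has no coarse embedding into a Hilbert space in a robust form:
    even a coarsely controlled map from a subset A of positive density must
    send a positive proportion of A into one bounded ball ([concentration]).
    The theorem follows from two applications of this fact.

    Composing h_n with G_n -> Q_n -> H and taking A = X_n, a positive proportion
    of X_n is sent into a ball of bounded radius of Q_n.  A ball of radius r
    of a k-generated group has a number of points bounded in terms of k and r,
    so a positive proportion of X_n is sent to a single point of Q_n, that is,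
    into one coset of N_n.  Left translation identifies this coset isometrically
    with N_n in its induced metric, so the embedding of N_n applies to this new
    set A, and a ball of G_n again has boundedly many points: a positive
    proportion of X_n has the same image in G_n.  A set of positive density has
    diameter at least logarithmic in |X_n|, since degrees are bounded, while
    expansion makes the diameter of X_n at most logarithmic; this gives
    the diameter bound.

    The difficulty in [concentration] is that A need not be connected, so that
    a map f on A has no bounded variation along edges.  Let F(x) be the value of
    f at a point of A close to x, with F = f on A.  It has bounded variation along
    edges that stay within a fixed distance r of A, and for large r all but
    a small proportion of the vertices are that close to A ([card_thickC]).
    The variation of F near the excluded vertices is not controlled at all, so
    they have to be removed; [expander_core] shows that deleting few vertices
    from an expander leaves a graph which contains an expander on almost all
    vertices.  The Poincare inequality on this remaining expander, for
    Hilbert-valued functions, bounds the mean square of |f x - f y|, and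
    an averaging argument concludes. *)

(** * Edge expansion and the Poincare inequality *)

Definition cutsize (T : finType) (e : rel T) (A B : {set T}) : nat :=
  (\sum_(x in A) \sum_(y in B) e x y)%N.

(** A lower bound on the Cheeger constant of the graph induced on B: edges
    leaving B are not counted. *)
Definition expands_in (R : realType) (T : finType) (e : rel T) (B : {set T})
    (eta : R) : Prop :=
  forall Z : {set T}, Z \subset B -> (#|Z|.*2 <= #|B|)%N ->
    eta * #|Z|%:R <= (cutsize e Z (B :\: Z))%:R.

Section Cheeger.
Variables (R : realType) (T : finType) (e : rel T) (B : {set T}) (eta : R).
Hypothesis expB : expands_in e B eta.

(** The L1 form of expansion.  Subtracting from u its least positive value on
    the whole support Z shrinks the support and lowers the right-hand side by that
    value times the cut of Z in B.  Expansion bounds this from below by eta |Z|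
    times the value, which is what the left-hand side loses. *)
Lemma coarea (u : T -> R) :
    (forall x, 0 <= u x) -> (#|[set x in B | u x != 0%R]%SET|.*2 <= #|B|)%N ->
  eta * \sum_(x in B) u x <=
    \sum_(x in B) \sum_(y in B) (e x y)%:R * Num.max 0 (u x - u y).
Proof.
have [n] := ubnP #|[set x in B | u x != 0%R]%SET|.
elim: n u => // n IH u supp_n u_ge0 supp_half.
set Z := [set x in B | u x != 0%R]%SET in supp_n supp_half.
have uB x : x \in B -> x \notin Z -> u x = 0.
  by move=> xB; rewrite inE xB /= negbK => /eqP.
have [Z0|[z zZ]] := set_0Vmem Z.
  rewrite big1 ?mulr0; last by move=> x xB; apply: uB => //; rewrite Z0 inE.
  apply: sumr_ge0 => x _; apply: sumr_ge0 => y _.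
  by rewrite mulr_ge0 ?ler0n// le_max lexx.
pose x0 := [arg min_(x < z in Z) u x]%O.
have [x0Z x0min] : x0 \in Z /\ forall x, x \in Z -> u x0 <= u x.
  by rewrite /x0; case: arg_minP.
have m_gt0 : 0 < u x0 by move: x0Z; rewrite inE lt_def u_ge0 => /andP[_ ->].
pose u' x := u x - u x0 * (x \in Z)%:R.
have u'_ge0 x : 0 <= Num.max 0 (u' x) by rewrite le_max lexx.
pose v x := Num.max 0 (u' x).
have vE x : x \in B -> v x = u' x.
  move=> xB; rewrite /v max_r// /u'; have [xZ|xZ] := boolP (x \in Z).
    by rewrite mulr1 subr_ge0 x0min.
  by rewrite mulr0 subr0.
have suppv : [set x in B | v x != 0%R]%SET \subset Z :\ x0.
  apply/fintype.subsetP => x; rewrite !inE => /andP[xB]; rewrite vE// /u' inE xB /=.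
  have [->|ux] := eqVneq (u x) 0; first by rewrite /= mulr0 subrr eqxx.
  by rewrite /= mulr1 subr_eq0 => h; rewrite andbT; apply: contra h => /eqP ->.
have cardv := subset_leq_card suppv.
have cardZ : #|Z| = #|Z :\ x0|.+1 by rewrite (cardsD1 x0 Z) x0Z.
have IHv : eta * (\sum_(x in B) v x) <=
  \sum_(x in B) \sum_(y in B) (e x y)%:R * Num.max 0 (v x - v y).
  apply: IH => //; first by rewrite (leq_ltn_trans cardv)// -cardZ.
  apply: leq_trans supp_half; rewrite leq_double (leq_trans cardv)//.
  by rewrite cardZ.
have ZB : Z \subset B by apply/fintype.subsetP => x; rewrite inE => /andP[].
have cutZ := expB ZB supp_half.
have -> : \sum_(x in B) u x = \sum_(x in B) v x + u x0 * #|Z|%:R.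
  rewrite (eq_bigr (fun x => v x + u x0 * (x \in Z)%:R)); last first.
    by move=> x xB; rewrite vE// /u' subrK.
  rewrite big_split /= -mulr_sumr; congr (_ + _ * _).
  rewrite -natr_sum -sum1_card; congr _%:R.
  rewrite (big_setID Z) /= (finset.setIidPr ZB) addnC big1 ?add0n; last first.
    by move=> x; rewrite inE => /andP[/negbTE ->].
  by apply: eq_bigr => x ->.
have cutE : (cutsize e Z (B :\: Z))%:R =
    \sum_(x in B) \sum_(y in B) (e x y)%:R * ((x \in Z) && (y \notin Z))%:R :> R.
  rewrite /cutsize natr_sum [RHS](big_setID Z) /= (finset.setIidPr ZB).
  rewrite [X in _ = _ + X]big1 ?addr0; last first.
    move=> x; rewrite inE => /andP[/negbTE -> _]; rewrite big1// => y _.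
    by rewrite mulr0.
  apply: eq_bigr => x xZ; rewrite natr_sum [RHS](big_setID Z) /=.
  rewrite [X in _ = X + _]big1 ?add0r; last first.
    by move=> y; rewrite inE => /andP[_ ->]; rewrite andbF mulr0.
  by apply: eq_bigr => y; rewrite inE xZ => /andP[-> _]; rewrite mulr1.
rewrite mulrDr.
have -> : \sum_(x in B) \sum_(y in B) (e x y)%:R * Num.max 0 (u x - u y) =
  \sum_(x in B) \sum_(y in B) (e x y)%:R * Num.max 0 (v x - v y) +
  u x0 * (cutsize e Z (B :\: Z))%:R.
  rewrite cutE mulr_sumr -big_split; apply: eq_bigr => x xB /=.
  rewrite mulr_sumr -big_split; apply: eq_bigr => y yB /=.
  rewrite mulrCA -mulrDr; congr (_ * _); rewrite !vE// /u'.
  have [xZ|xZ] := boolP (x \in Z); have [yZ|yZ] := boolP (y \in Z) => /=.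
  - by rewrite !mulr1 mulr0 addr0; congr Num.max; ring.
  - rewrite (uB y)// !mulr1 !mulr0 !subr0.
    by rewrite !max_r ?subr_ge0 ?x0min// subrK.
  - rewrite (uB x)// !mulr1 !mulr0 !subr0 addr0 !sub0r opprB.
    by rewrite !max_l ?oppr_le0// subr_le0 x0min.
  - by rewrite !mulr0 addr0 !subr0.
by rewrite lerD// mulrCA ler_pM2l.
Qed.

Variable D : nat.
Hypothesis eta_gt0 : 0 < eta.
Hypothesis e_sym : symmetric e.
Hypothesis e_deg : forall x, (\sum_(y in B) e x y <= D.+1)%N.

Let energy (u : T -> R) : R :=
  \sum_(x in B) \sum_(y in B) (e x y)%:R * (u x - u y) ^+ 2.

(** Apply [coarea] to u ^+ 2 and bound the variation of u ^+ 2 along an edge,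
    by the arithmetic-geometric mean inequality, by the squared variation of u
    and a small multiple of u ^+ 2.  Degrees are bounded, so the latter terms add up
    to at most half of the left-hand side. *)
Lemma cheeger_half_supp (u : T -> R) :
    (forall x, 0 <= u x) -> (#|[set x in B | u x != 0%R]%SET|.*2 <= #|B|)%N ->
  \sum_(x in B) u x ^+ 2 <= 4 * D.+1%:R / eta ^+ 2 * energy u.
Proof.
move=> u_ge0 supp_half; set S2 := \sum_(x in B) _.
have S2_ge0 : 0 <= S2 by apply: sumr_ge0 => x _; exact: sqr_ge0.
pose d : R := D.+1%:R; have d_gt0 : 0 < d by rewrite ltr0n.
(* The weight for which the terms u ^+ 2 on the right have total coefficient
   eta / 2. *)
pose lam : R := 4 * d / eta.
have lam_gt0 : 0 < lam by rewrite divr_gt0// mulr_gt0.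
have deg_sum (w : T -> R) : (forall x, 0 <= w x) ->
    \sum_(x in B) \sum_(y in B) (e x y)%:R * w x <= d * \sum_(x in B) w x.
  move=> w_ge0; rewrite mulr_sumr; apply: ler_sum => x xB.
  by rewrite -mulr_suml -natr_sum ler_wpM2r// ler_nat.
have coar := @coarea (fun x => u x ^+ 2) (fun x => sqr_ge0 _).
have {coar} : eta * S2 <= \sum_(x in B) \sum_(y in B)
    (e x y)%:R * Num.max 0 (u x ^+ 2 - u y ^+ 2).
  apply: coar; rewrite (_ : [set x in B | _]%SET = [set x in B | u x != 0%R]%SET)//.
  by apply/setP => x; rewrite !inE sqrf_eq0.
have edge_le x y : Num.max 0 (u x ^+ 2 - u y ^+ 2) <=
    lam / 2 * (u x - u y) ^+ 2 + (u x ^+ 2 + u y ^+ 2) / lam.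
  have lam_neq0 : lam != 0 by rewrite gt_eqF.
  have amgm a b : a * b <= lam / 2 * a ^+ 2 + b ^+ 2 / (2 * lam).
    rewrite -subr_ge0 (_ : _ - _ = (lam * a - b) ^+ 2 / (2 * lam)).
      by rewrite divr_ge0 ?sqr_ge0// mulr_ge0// ltW.
    by field.
  rewrite ge_max; apply/andP; split.
    apply: addr_ge0; first by rewrite mulr_ge0 ?sqr_ge0// divr_ge0// ltW.
    by rewrite divr_ge0 ?addr_ge0 ?sqr_ge0// ltW.
  rewrite subr_sqr (le_trans (amgm _ _))// lerD2l invfM mulrA.
  rewrite ler_pM2r ?invr_gt0//; have := sqr_ge0 (u x - u y); lra.
move=> /le_trans/(_ (ler_sum _ (fun x _ => ler_sum _ (fun y _ =>
  ler_wpM2l (ler0n _ _) (edge_le x y))))).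
rewrite (eq_bigr (fun x => lam / 2 * (\sum_(y in B) (e x y)%:R * (u x - u y) ^+ 2) +
  (\sum_(y in B) (e x y)%:R * (u x ^+ 2 / lam) +
   \sum_(y in B) (e x y)%:R * (u y ^+ 2 / lam)))); last first.
  move=> x _; rewrite mulr_sumr -!big_split /=; apply: eq_bigr => y _.
  by rewrite !mulrDr !mulrDl !mulrDr; congr (_ + _); rewrite mulrCA.
rewrite big_split /= -mulr_sumr -/(energy u) big_split /=.
have w_ge0 x : 0 <= u x ^+ 2 / lam by rewrite divr_ge0 ?sqr_ge0// ltW.
have h1 := deg_sum _ w_ge0.
have h2 : \sum_(x in B) \sum_(y in B) (e x y)%:R * (u y ^+ 2 / lam) <=
    d * \sum_(x in B) (u x ^+ 2 / lam).
  rewrite exchange_big /= (le_trans _ h1)//.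
  by under eq_bigr => x _ do under eq_bigr => y _ do rewrite e_sym.
move: h1 h2; rewrite -mulr_suml -/S2 => h1 h2 h.
have dlam : d * (S2 / lam) = eta * S2 / 4.
  by rewrite /lam; field; rewrite !gt_eqF.
rewrite dlam in h1 h2.
have h3 : eta * S2 / 2 <= lam / 2 * energy u by lra.
rewrite -(ler_pM2l (_ : 0 < eta / 2)) ?divr_gt0//.
rewrite (_ : _ * (_ * energy u) = lam / 2 * energy u); last first.
  by rewrite /lam/d; field; rewrite gt_eqF.
lra.
Qed.

(** The least value of u that is exceeded on at most half of B is a median. *)
Lemma median_exists (u : T -> R) : B != finset.set0 -> exists m,
  (#|[set x in B | (m < u x)%R]%SET|.*2 <= #|B|)%N /\
  (#|[set x in B | (u x < m)%R]%SET|.*2 <= #|B|)%N.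
Proof.
case/set0Pn => b bB.
pose up x := [set y in B | (u x < u y)%R]%SET.
pose P := [pred x | (x \in B) && (#|up x|.*2 <= #|B|)%N].
have [top topP] : exists x, P x.
  pose x := [arg max_(x > b in B) u x]%O.
  have [xB xmax] : x \in B /\ forall y, y \in B -> u y <= u x.
    by rewrite /x; case: arg_maxP.
  exists x; rewrite /= xB (_ : up x = finset.set0) ?cards0//.
  apply/setP => y; rewrite !inE; apply/negbTE/negP => /andP[yB].
  by rewrite ltNge xmax.
pose x := [arg min_(x < top | P x) u x]%O.
have [/andP[xB upx] xmin] : P x /\ forall y, P y -> u x <= u y.
  by rewrite /x; case: arg_minP.
exists (u x); split => //.
have [->|[z0 z0P]] := set_0Vmem [set y in B | (u y < u x)%R]%SET; first by rewrite cards0.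
pose z := [arg max_(z > z0 in [set y in B | (u y < u x)%R]%SET) u z]%O.
have [zP zmax] : z \in [set y in B | (u y < u x)%R]%SET /\
    forall y, y \in [set y in B | (u y < u x)%R]%SET -> u y <= u z.
  by rewrite /z; case: arg_maxP.
move: zP; rewrite inE => /andP[zB zx].
have : ~~ (#|up z|.*2 <= #|B|)%N.
  by apply/negP => h; have := xmin z; rewrite /= zB h leNgt zx => /(_ isT).
rewrite -ltnNge => upz.
have disj : (#|up z| + #|[set y in B | (u y < u x)%R]%SET| <= #|B|)%N.
  rewrite -cardsUI [X in (_ + X)%N](_ : _ = 0%N) ?addn0.
    by apply/subset_leq_card/fintype.subsetP => y; rewrite !inE => /orP[]/andP[].
  apply/eqP; rewrite cards_eq0; apply/eqP/setP => y; rewrite !inE.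
  apply/negbTE/negP => /andP[/andP[yB zy] /andP[_ yx]].
  by have := zmax y; rewrite inE yB yx leNgt zy => /(_ isT).
by move: upz disj; rewrite -!addnn; lia.
Qed.

(** Cheeger's inequality.  Split u - m, for a median m of u, into its positive
    and negative parts: each is supported on at most half of B, so
    [cheeger_half_supp] applies, and their energies add up to at most that of
    u. *)
Lemma poincare (u : T -> R) :
  \sum_(x in B) \sum_(y in B) (u x - u y) ^+ 2 <=
    #|B|%:R * (16 * D.+1%:R / eta ^+ 2) * energy u.
Proof.
have [->|B0] := eqVneq B finset.set0.
  by rewrite big_set0 cards0 !mul0r.
have [m [up_half down_half]] := median_exists u B0.
pose p x := Num.max 0 (u x - m); pose q x := Num.max 0 (m - u x).
have p_ge0 x : 0 <= p x by rewrite le_max lexx.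
have q_ge0 x : 0 <= q x by rewrite le_max lexx.
have pE : [set x in B | p x != 0%R]%SET = [set x in B | (m < u x)%R]%SET.
  apply/setP => x; rewrite !inE; congr (_ && _); rewrite -subr_gt0 /p.
  by case: (ltP 0 (u x - m)) => [h|h]; rewrite ?eqxx// gt_eqF.
have qE : [set x in B | q x != 0%R]%SET = [set x in B | (u x < m)%R]%SET.
  apply/setP => x; rewrite !inE; congr (_ && _); rewrite -subr_gt0 /q.
  by case: (ltP 0 (m - u x)) => [h|h]; rewrite ?eqxx// gt_eqF.
have Hp := cheeger_half_supp p_ge0; rewrite pE in Hp; move/(_ up_half) in Hp.
have Hq := cheeger_half_supp q_ge0; rewrite qE in Hq; move/(_ down_half) in Hq.
have energy_le : energy p + energy q <= energy u.
  rewrite -big_split /=; apply: ler_sum => x _.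
  rewrite -big_split /=; apply: ler_sum => y _.
  rewrite -mulrDr ler_wpM2l// /p /q.
  by case: (leP 0 (u x - m)); case: (leP 0 (u y - m));
    case: (leP 0 (m - u x)); case: (leP 0 (m - u y)); nra.
have sqE x : (u x - m) ^+ 2 = p x ^+ 2 + q x ^+ 2.
  rewrite /p /q -[m - u x]opprB; have [h|h] := leP 0 (u x - m).
    by rewrite [Num.max _ (- _)]max_l ?oppr_le0// expr0n addr0.
  by rewrite max_r ?oppr_ge0 ?ltW// sqrrN expr0n add0r.
pose V := \sum_(x in B) (u x - m) ^+ 2.
have VE : V <= 4 * D.+1%:R / eta ^+ 2 * energy u.
  rewrite /V (eq_bigr _ (fun x _ => sqE x)) big_split /=.
  rewrite (le_trans (lerD Hp Hq))// -mulrDr ler_wpM2l//.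
  by rewrite divr_ge0 ?sqr_ge0// mulr_ge0.
apply: (@le_trans _ _ (\sum_(x in B) \sum_(y in B)
    (2 * (u x - m) ^+ 2 + 2 * (u y - m) ^+ 2))).
  apply: ler_sum => x _; apply: ler_sum => y _.
  have := sqr_ge0 (u x - m + (u y - m)); lra.
rewrite (eq_bigr (fun x => 2 * (u x - m) ^+ 2 * #|B|%:R + 2 * V)); last first.
  by move=> x _; rewrite big_split /= sumr_const -[_ *+ #|_|]mulr_natr -mulr_sumr.
rewrite big_split /= sumr_const -mulr_suml -mulr_sumr -/V -[(2 * V) *+ _]mulr_natl.
rewrite (_ : _ + _ = #|B|%:R * (4 * V)); last by ring.
rewrite -mulrA ler_wpM2l // (le_trans (ler_wpM2l _ VE)) //.
by rewrite le_eqVlt; apply/orP; left; apply/eqP; field; rewrite gt_eqF.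
Qed.

End Cheeger.

(** * Hilbert-valued functions *)

(** Orthogonal decomposition along v: a is the coordinate and r the projection
    to the orthogonal complement. *)
Lemma hilbert_split (R : realType) (H : completeNormedModType R) (v : H) :
  is_hilbert H -> v != 0 ->
  exists (a : H -> R) (r : H -> H),
    [/\ r 0 = 0, r v = 0 &
        forall x y, `|x - y| ^+ 2 = (a x - a y) ^+ 2 + `|r x - r y| ^+ 2].
Proof.
move=> [dot dotE] v0.
have dotC x y : dot x y = dot y x.
  by have := hermC dot x y; rewrite expr0 mul1r.
have nv : `|v| != 0 by rewrite normr_eq0.
pose e := `|v|^-1 *: v.
have ee : dot e e = 1.
  by rewrite -dotE normrZ normfV normr_id mulVf// expr1n.
have ve : dot v e *: e = v.
  have -> : dot v e = `|v| by rewrite dotC {1}/e linearZl_LR /= -dotE expr2 mulKf.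
  by rewrite /e scalerA divff// scale1r.
clearbody e; pose r x := x - dot x e *: e.
have r_lin x y : r x - r y = (x - y) - dot (x - y) e *: e.
  by rewrite /r linearBl /= scalerBl !opprD addrACA.
exists (fun x => dot x e), r; split.
- by rewrite /r linear0l scale0r subr0.
- by rewrite /r ve subrr.
- move=> x y; rewrite r_lin -linearBl /= !dotE; move: (x - y) => z.
  rewrite linearBl /= linearZl_LR /= !(dotC _ (_ - _)) !linearBl /=.
  rewrite !linearZl_LR /= ee (dotC e z).
  ring.
Qed.

(** A quadratic inequality between differences passes from real-valued to
    Hilbert-valued functions, as if coordinate by coordinate.  No basis is
    needed: splitting off the direction of one nonzero value f z contributes
    a real-valued term and leaves a function with fewer nonzero values. *)
Lemma hilbert_transfer (R : realType) (H : completeNormedModType R) (T : finType)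
    (w : T -> T -> R) : is_hilbert H ->
    (forall a : T -> R, 0 <= \sum_x \sum_y w x y * (a x - a y) ^+ 2) ->
  forall f : T -> H, 0 <= \sum_x \sum_y w x y * `|f x - f y| ^+ 2.
Proof.
move=> hH w_ge0 f.
have [n] := ubnP #|[set x | f x != 0]%SET|.
elim: n f => // n IH f supp_n.
have [f0|[z]] := set_0Vmem [set x | f x != 0]%SET.
  rewrite big1// => x _; rewrite big1// => y _.
  have fx0 u : f u = 0.
    by apply/eqP/negPn; rewrite -[_ != _](finset.in_set (fun u => f u != 0)) f0 inE.
  by rewrite !fx0 subrr normr0 expr0n mulr0.
rewrite inE => fz.
have [a [r [r0 rz split_norm]]] := hilbert_split hH fz.
under eq_bigr => x _ do under eq_bigr => y _ do rewrite split_norm mulrDr.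
under eq_bigr => x _ do rewrite big_split.
rewrite big_split /=; apply: addr_ge0; first exact: (w_ge0 (a \o f)).
apply: (IH (r \o f)); rewrite ltnS in supp_n; apply: leq_trans supp_n.
apply: proper_card; apply/properP; split.
  by apply/fintype.subsetP => x; rewrite !inE /=; apply: contra => /eqP ->; rewrite r0.
by exists z; rewrite inE//= rz eqxx.
Qed.

Lemma hilbert_poincare (R : realType) (H : completeNormedModType R)
    (T : finType) (e : rel T) (B : {set T}) (eta : R) (D : nat) :
    is_hilbert H -> expands_in e B eta -> 0 < eta -> symmetric e ->
    (forall x, (\sum_(y in B) e x y <= D.+1)%N) ->
  forall u : T -> H,
  \sum_(x in B) \sum_(y in B) `|u x - u y| ^+ 2 <=
    #|B|%:R * (16 * D.+1%:R / eta ^+ 2) *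
      \sum_(x in B) \sum_(y in B) (e x y)%:R * `|u x - u y| ^+ 2.
Proof.
move=> hH expB eta0 e_sym e_deg u; set C := _ * (_ / _).
(* The weight whose quadratic form is the difference of the two sides. *)
pose w x y : R := ((x \in B) && (y \in B))%:R * (C * (e x y)%:R - 1).
have wE (F : T -> T -> R) : \sum_x \sum_y w x y * F x y =
   C * (\sum_(x in B) \sum_(y in B) (e x y)%:R * F x y) - \sum_(x in B) \sum_(y in B) F x y.
  rewrite mulr_sumr -sumrB [RHS]big_mkcond; apply: eq_bigr => x _.
  rewrite /w; case: (x \in B) => /=; last by rewrite big1// => y _; rewrite !mul0r.
  rewrite mulr_sumr -sumrB [RHS]big_mkcond; apply: eq_bigr => y _.
  by case: (y \in B); rewrite /= ?mul0r// mul1r mulrBl mul1r mulrA.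
rewrite -subr_ge0 -(wE (fun x y => `|u x - u y| ^+ 2)); apply: hilbert_transfer => // a.
by rewrite (wE (fun x y => (a x - a y) ^+ 2)) subr_ge0; exact: poincare.
Qed.

(** * Cuts, neighbourhoods and expanding subsets *)

Section Cut.
Variables (T : finType) (e : rel T).
Hypothesis e_sym : symmetric e.
Implicit Types A B C : {set T}.

Lemma cutC A B : cutsize e A B = cutsize e B A.
Proof.
rewrite /cutsize exchange_big /=; apply: eq_bigr => x _; apply: eq_bigr => y _.
by rewrite e_sym.
Qed.

Lemma cut_subl A A' B : A \subset A' -> (cutsize e A B <= cutsize e A' B)%N.
Proof.
move=> /finset.setIidPr AA'; rewrite /cutsize (big_setID (A := A') A) /= AA'.
exact: leq_addr.
Qed.

Lemma cut_subr A B B' : B \subset B' -> (cutsize e A B <= cutsize e A B')%N.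
Proof. by rewrite ![cutsize e A _]cutC; exact: cut_subl. Qed.

Lemma cutUl A A' B : (cutsize e (A :|: A') B <= cutsize e A B + cutsize e A' B)%N.
Proof.
rewrite /cutsize (big_setID (A := A :|: A') A) /= (finset.setIidPr (finset.subsetUl _ _)) leq_add2l.
by apply: cut_subl; rewrite finset.setDUl finset.setDv finset.set0U finset.subsetDl.
Qed.

Lemma cutUr A B B' : (cutsize e A (B :|: B') <= cutsize e A B + cutsize e A B')%N.
Proof. by rewrite ![cutsize e A _]cutC; exact: cutUl. Qed.

Variable D : nat.
Hypothesis e_deg : forall x, (#|[set y | e x y]%SET| <= D)%N.

Lemma sum_deg x B : (\sum_(y in B) e x y <= D)%N.
Proof.
apply: leq_trans (e_deg x); rewrite -sum1_card.
rewrite [X in (_ <= X)%N]big_mkcond [X in (X <= _)%N]big_mkcond /=.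
by apply: leq_sum => y _; rewrite inE; case: (y \in B); case: (e x y).
Qed.

Lemma cut_deg A B : (cutsize e A B <= D * #|A|)%N.
Proof.
by rewrite mulnC -sum_nat_const; apply: leq_sum => x _; exact: sum_deg.
Qed.

Definition nbr A := (A :|: [set y | [exists x in A, e x y]])%SET.

(** The r-neighbourhood of A for the graph metric. *)
Definition thick r A := iter r nbr A.

Lemma sub_thick r A : A \subset thick r A.
Proof.
elim: r => //= r IH; apply: fintype.subset_trans IH _; exact: finset.subsetUl.
Qed.

Lemma cut_nbr A : (cutsize e A (~: A) <= D * #|nbr A :\: A|)%N.
Proof.
rewrite cutC; suff: (cutsize e (~: A) A <= cutsize e (nbr A :\: A) A)%N.
  by move=> /leq_trans; apply; exact: cut_deg.
rewrite {1}/cutsize (big_setID (nbr A :\: A)) /= [X in (_ + X)%N]big1 ?addn0.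
  by apply: cut_subl; exact: finset.subsetIr.
move=> y; rewrite !inE => /andP[]; case: (boolP (y \in A)) => //= _ h _.
rewrite big1// => x xA; apply/eqP; rewrite eqb0; apply: contra h => yx.
by apply/existsP; exists x; rewrite xA e_sym.
Qed.

Lemma card_thick r x : (#|thick r [set x]| <= D.+1 ^ r)%N.
Proof.
elim: r => [|r IH]; first by rewrite cards1.
rewrite expnS; apply: (@leq_trans (D.+1 * #|thick r [set x]|)%N); last by rewrite leq_mul2l IH.
rewrite /= -/(thick r _); move: (thick r _) => A.
rewrite (leq_trans (leq_card_setU _ _))// mulSn leq_add2l.
have -> : [set y | [exists x0 in A, e x0 y]]%SET = (\bigcup_(x in A) [set y | e x y])%SET.
  apply/setP => y; rewrite inE; apply/existsP/finset.bigcupP.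
    by move=> [z /andP[zA zy]]; exists z; rewrite ?inE.
  by move=> [z zA]; rewrite inE => zy; exists z; rewrite zA.
apply: (@leq_trans (\sum_(x in A) #|[set y | e x y]%SET|)%N).
  elim/big_rec2: _ => [|z m B zA IHz]; first by rewrite cards0.
  by rewrite (leq_trans (leq_card_setU _ _))// leq_add2l.
by rewrite mulnC -sum_nat_const; apply: leq_sum.
Qed.

End Cut.

Section Isoperimetry.
Variables (R : realType) (T : finType) (e : rel T) (c0 : R) (D : nat).
Hypothesis e_sym : symmetric e.
Hypothesis c0_gt0 : 0 < c0.
Hypothesis e_deg : forall x, (#|[set y | e x y]%SET| <= D)%N.
Hypothesis iso : forall A : {set T}, (#|A|.*2 <= #|T|)%N ->
  c0 * #|A|%:R <= (cutsize e A (~: A))%:R.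

Lemma cardCR (A : {set T}) : #|T|%:R = #|A|%:R + #|~: A|%:R :> R.
Proof. by rewrite -natrD cardsC. Qed.

Lemma isoC (A : {set T}) : (#|T| <= #|A|.*2)%N ->
  c0 * #|~: A|%:R <= (cutsize e A (~: A))%:R.
Proof.
move=> h; have := iso (A := ~: A); rewrite finset.setCK cutC//; apply.
by rewrite cardsCs finset.setCK -addnn; move: h (max_card (mem A)); rewrite -addnn; lia.
Qed.

(** Combines the bounds for small and for large sets in one inequality that
    needs no case distinction when the thickening of a set passes half of
    the graph. *)
Lemma iso_mul (A : {set T}) :
  c0 * #|A|%:R * #|~: A|%:R <= #|T|%:R * (cutsize e A (~: A))%:R.
Proof.
have TE := cardCR A; have a0 := ler0n R #|A|; have b0 := ler0n R #|~: A|.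
have k0 := ler0n R (cutsize e A (~: A)); rewrite TE.
case: (leqP #|A|.*2 #|T|) => h.
  have := ler_wpM2r b0 (iso h); have := mulr_ge0 a0 k0; lra.
have := ler_wpM2r a0 (isoC (ltnW h)); have := mulr_ge0 b0 k0; lra.
Qed.

(** The threshold 2/3 leaves room in [expander_core] to add a set of at most half
    of the vertices to a small one. *)
Lemma iso_two_thirds (A : {set T}) : (3 * #|A| <= #|T|.*2)%N ->
  c0 / 2 * #|A|%:R <= (cutsize e A (~: A))%:R.
Proof.
rewrite -muln2 -(ler_nat R) !natrM => h.
have TE := cardCR A; have a0 := ler0n R #|A|; have b0 := ler0n R #|~: A|.
case: (leqP #|A|.*2 #|T|) => hA; first by have := iso hA; have := mulr_ge0 (ltW c0_gt0) a0; lra.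
have ab : #|A|%:R / 2 <= #|~: A|%:R :> R by lra.
by have := isoC (ltnW hA); have := ler_wpM2l (ltW c0_gt0) ab; lra.
Qed.

Lemma card_nbr (A : {set T}) : #|nbr e A :\: A|%:R = #|~: A|%:R - #|~: nbr e A|%:R :> R.
Proof.
have := cardCR A; have := cardCR (nbr e A).
have -> : #|nbr e A|%:R = #|A|%:R + #|nbr e A :\: A|%:R :> R.
  rewrite -natrD -[in LHS](cardsID A); congr (_ + _)%:R; congr #|pred_of_set _|.
  by apply/finset.setIidPr; exact: finset.subsetUl.
lra.
Qed.

(** The complement of the r-neighbourhood of a set of density alpha has density
    O(1/r).  By [iso_mul], one further step removes from the complement at
    least a fraction c0 * alpha / D of it.  This decay is in fact geometric, but
    the weaker bound suffices and avoids powers. *)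
Lemma card_thickC (A : {set T}) (alpha : R) : 0 < alpha ->
    alpha * #|T|%:R <= #|A|%:R -> forall r,
  c0 * alpha * r%:R * #|~: thick e r A|%:R <= D%:R * (#|T|%:R - #|~: thick e r A|%:R).
Proof.
move=> alpha_gt0 hA; elim=> [|r IH].
  by rewrite mulr0 mul0r mulr_ge0// (cardCR A) /= addrK.
have hB : alpha * #|T|%:R <= #|thick e r A|%:R.
  by rewrite (le_trans hA)// ler_nat subset_leq_card// sub_thick.
move: IH; rewrite /= -/(thick e r A); move: (thick e r A) hB => B hB IH.
have h1 := iso_mul B.
have h2 : (cutsize e B (~: B))%:R <= D%:R * #|nbr e B :\: B|%:R :> R.
  by rewrite -natrM ler_nat cut_nbr.
have b0 := ler0n R #|~: B|; have b1 := ler0n R #|~: nbr e B|.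
have n1 := ler0n R #|nbr e B :\: B|.
have h3 : c0 * alpha * #|~: B|%:R <= D%:R * #|nbr e B :\: B|%:R.
  have [T0|T0] := posnP #|T|.
    have : #|~: B|%:R = 0 :> R.
      by apply/eqP; rewrite pnatr_eq0 -leqn0 -T0 max_card.
    by move=> ->; rewrite mulr0 mulr_ge0.
  have T0' : 0 < #|T|%:R :> R by rewrite ltr0n.
  have h4 : c0 * (alpha * #|T|%:R) * #|~: B|%:R <= c0 * #|B|%:R * #|~: B|%:R.
    by rewrite ler_wpM2r// ler_pM2l.
  have h5 : #|T|%:R * (cutsize e B (~: B))%:R <= #|T|%:R * (D%:R * #|nbr e B :\: B|%:R) :> R.
    by rewrite ler_pM2l.
  by rewrite -(ler_pM2l T0'); lra.
rewrite card_nbr in h3 n1; rewrite -natr1.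
have mono : #|~: nbr e B|%:R <= #|~: B|%:R :> R by lra.
have ca := mulr_ge0 (ltW c0_gt0) (ltW alpha_gt0).
have := ler_wpM2l ca mono.
have := ler_wpM2l (mulr_ge0 ca (ler0n R r)) mono.
lra.
Qed.

(** Let W be a largest set of vertices outside Z whose boundary outside Z is
    small.  In the whole graph W has many boundary edges, so at
    least c0 / 4 * |W| of them end in Z, which bounds |W| by a multiple of |Z|.
    A set V with small boundary in the complement of Z and W could be added to
    W, against maximality. *)
Lemma expander_core (Z : {set T}) :
    24 * D%:R * #|Z|%:R <= c0 * #|T|%:R ->
  exists B : {set T}, [/\ B \subset ~: Z, expands_in e B (c0 / 4) &
    c0 * #|~: B|%:R <= (c0 + 4 * D%:R) * #|Z|%:R].
Proof.
move=> hZ.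
pose P (W : {set T}) := [&& W \subset ~: Z, (3 * #|W| <= #|T|.*2)%N &
  (cutsize e W (~: Z :\: W))%:R <= c0 / 4 * #|W|%:R].
have P0 : P finset.set0.
  by rewrite /P finset.sub0set cards0 muln0 /= mulr0 /cutsize big_set0.
pose W := [arg max_(W > finset.set0 | P W) #|W|].
have [/and3P[WZ W23 Wcut] Wmax] : P W /\ forall V, P V -> (#|V| <= #|W|)%N.
  by rewrite /W; case: arg_maxnP.
have hW : c0 / 4 * #|W|%:R <= D%:R * #|Z|%:R.
  have : (cutsize e W (~: W))%:R <= (cutsize e W (~: Z :\: W))%:R + D%:R * #|Z|%:R :> R.
    rewrite -natrM -natrD ler_nat (@leq_trans (cutsize e W ((~: Z :\: W) :|: Z)))//.
      apply: cut_subr => //; apply/fintype.subsetP => x; rewrite !inE => ->.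
      by case: (x \in Z).
    rewrite (leq_trans (cutUr _ _ _ _))// leq_add2l cutC//; exact: cut_deg.
  have := iso_two_thirds W23; lra.
have W6 : (6 * #|W| <= #|T|)%N.
  by rewrite -(ler_nat R) natrM -(ler_pM2l c0_gt0); lra.
exists (~: Z :\: W); split.
- exact: finset.subsetDl.
- move=> V VB Vhalf; rewrite leNgt; apply/negP => Vcut.
  have VW : W :&: V = finset.set0.
    apply/setP => x; rewrite !inE; apply/negbTE/negP => /andP[xW /(fintype.subsetP VB)].
    by rewrite !inE xW.
  have V_gt0 : (0 < #|V|)%N.
    rewrite lt0n; apply/eqP => V0; move: Vcut; rewrite V0 mulr0.
    by rewrite ltNge ler0n.
  have cardWV : #|W :|: V| = (#|W| + #|V|)%N by rewrite -cardsUI VW cards0 addn0.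
  have : P (W :|: V).
    apply/and3P; split.
    + rewrite finset.subUset WZ; apply: fintype.subset_trans VB _.
      exact: finset.subsetDl.
    + have hT : (#|~: Z :\: W| <= #|T|)%N by exact: max_card.
      by move: hT; rewrite cardWV; move: Vhalf W6; rewrite -!addnn; lia.
    + rewrite cardWV natrD mulrDr.
      apply: (@le_trans _ _ ((cutsize e W (~: Z :\: W))%:R +
                             (cutsize e V (~: Z :\: W :\: V))%:R)).
        rewrite -natrD ler_nat (leq_trans (cutUl _ _ _ _))// leq_add//.
          by apply: cut_subr => //; apply/finset.setDS; exact: finset.subsetUl.
        by rewrite finset.setDDl.
      by rewrite lerD// ltW.
  by move=> /Wmax; rewrite cardWV -[X in (_ <= X)%N]addn0 leq_add2l leqNgt V_gt0.
- have h : #|~: (~: Z :\: W)|%:R <= #|Z|%:R + #|W|%:R :> R.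
    rewrite -natrD ler_nat finset.setDE finset.setCI !finset.setCK.
    exact: leq_card_setU.
  by have := ler_wpM2l (ltW c0_gt0) h; lra.
Qed.

End Isoperimetry.

(** * The graph metric and concentration *)

Lemma leastP (P : set nat) : (exists n, P n) -> P (least P).
Proof.
move=> [n Pn]; rewrite /least; case: pselect => [exP|[]]; last first.
  by exists n; apply/asboolP.
by case: ex_minnP => m /asboolP.
Qed.

Lemma least_le (P : set nat) n : P n -> (least P <= n)%N.
Proof.
move=> Pn; rewrite /least; case: pselect => [exP|//].
by case: ex_minnP => m _; apply; apply/asboolP.
Qed.

Section GraphDist.
Variable X : sgraph.
Hypothesis X_conn : connected_graph X.
Implicit Types (x y z : X) (A : {set X}).

Lemma graph_dist_path x (p : seq X) :
  path (@adj X) x p -> (graph_dist x (last x p) <= size p)%N.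
Proof. by move=> xp; apply: least_le; exists p. Qed.

Lemma graph_dist_ex x y :
  exists p : seq X, [/\ path (@adj X) x p, last x p = y & size p = graph_dist x y].
Proof.
apply: (@leastP [set l | exists p : seq X,
  [/\ path (@adj X) x p, last x p = y & size p = l]]).
by have /connectP[p xp yE] := X_conn.2 x y; exists (size p), p.
Qed.

Lemma graph_dist_tri x y z : (graph_dist x z <= graph_dist x y + graph_dist y z)%N.
Proof.
have [p [xp yE <-]] := graph_dist_ex x y.
have [q [yq zE <-]] := graph_dist_ex y z.
rewrite -size_cat -zE -yE -last_cat; apply: graph_dist_path.
by rewrite cat_path xp yE.
Qed.

Lemma graph_dist_sym x y : graph_dist x y = graph_dist y x.
Proof.
suff le_sym (u v : X) : (graph_dist v u <= graph_dist u v)%N by apply/eqP; rewrite eqn_leq !le_sym.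
have [p [up <- <-]] := graph_dist_ex u v.
have -> : size p = size (rev (belast u p)) by rewrite size_rev size_belast.
have {2}-> : u = last (last u p) (rev (belast u p)).
  by case: p {up} => //= a p; rewrite rev_cons last_rcons.
apply: graph_dist_path; rewrite rev_path.
by rewrite (eq_path (e' := @adj X))// => a b; rewrite /= adj_sym.
Qed.

Lemma graph_dist_adj x y : adj x y -> (graph_dist x y <= 1)%N.
Proof. by move=> xy; apply: (@graph_dist_path x [:: y]); rewrite /= xy. Qed.

Lemma graph_dist0 x : graph_dist x x = 0%N.
Proof. by apply/eqP; rewrite -leqn0; apply: (@graph_dist_path x [::]). Qed.

Lemma thick_dist r A y : y \in thick (@adj X) r A ->
  exists2 x, x \in A & (graph_dist x y <= r)%N.
Proof.
elim: r y => [|r IH] y; first by exists y; rewrite ?graph_dist0.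
rewrite /= -/(thick _ r A) inE => /orP[/IH[x xA xy]|]; first by exists x => //; exact: leqW.
rewrite inE => /existsP[z /andP[/IH[x xA xz] zy]]; exists x => //.
rewrite (leq_trans (graph_dist_tri x z y))// -addn1 leq_add//.
exact: graph_dist_adj.
Qed.

Lemma dist_thick r x y : (graph_dist x y <= r)%N -> y \in thick (@adj X) r [set x]%SET.
Proof.
have [p [xp <- <-]] := graph_dist_ex x y.
elim/last_ind: p r xp {y} => [|p z IH] r.
  by move=> _ _; apply: (fintype.subsetP (sub_thick _ _ _)); rewrite inE.
rewrite rcons_path last_rcons size_rcons => /andP[xp pz].
case: r => // r pr; rewrite /= -/(thick _ r _) finset.in_setU; apply/orP; right.
by rewrite inE; apply/existsP; exists (last x p); rewrite IH.
Qed.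

Lemma graph_dist_diam A x y : x \in A -> y \in A -> (graph_dist x y <= diam A)%N.
Proof.
move=> xA yA; apply: leq_trans (leq_bigmax_cond _ xA).
exact: (leq_bigmax_cond (F := graph_dist x)).
Qed.

Lemma card_edge_boundary A : #|edge_boundary A| = cutsize (@adj X) A (~: A).
Proof.
rewrite /cutsize pair_big_dep /= -sum1_card big_mkcond [RHS]big_mkcond /=.
apply: eq_bigr => -[x y] _; rewrite !inE /=.
by case: (x \in A); case: (y \in A); case: (adj x y).
Qed.

Lemma cheeger_cut (R : realType) (c0 : R) : (c0%:E <= cheeger X R)%E ->
  forall A, (#|A|.*2 <= #|X|)%N -> c0 * #|A|%:R <= (cutsize (@adj X) A (~: A))%:R.
Proof.
move=> hc A hA; rewrite -card_edge_boundary.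
have [A0|A0] := posnP #|A|; first by rewrite A0 mulr0.
rewrite -ler_pdivlMr ?ltr0n// -lee_fin (le_trans hc)// /cheeger.
by apply: bigmin_le_cond; rewrite A0 hA.
Qed.

End GraphDist.

Definition bounded_expander (R : realType) (D : nat) (c0 : R) (X : sgraph) : Prop :=
  [/\ connected_graph X, forall x : X, (#|[set y | adj x y]%SET| <= D)%N &
      (c0%:E <= cheeger X R)%E].

(** L controls f only on A, where f is a coarse map for the metric of X.
    The order of the quantifiers matters: C and beta
    have to serve a whole sequence of graphs at once. *)
Lemma concentration (R : realType) (D : nat) (c0 alpha : R) (L : nat -> R) :
    0 < c0 -> 0 < alpha ->
  exists C beta : R, 0 < beta /\
    forall (X : sgraph) (H : completeNormedModType R) (A : {set X}) (f : X -> H),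
      is_hilbert H -> bounded_expander D c0 X -> alpha * #|X|%:R <= #|A|%:R ->
      (forall x y m, x \in A -> y \in A -> (graph_dist x y <= m)%N ->
         `|f x - f y| <= L m) ->
    exists2 x, x \in A &
      beta * #|X|%:R <= #|[set y in A | (`|f x - f y| <= C)%R]%SET|%:R.
Proof.
move=> c0_gt0 al_gt0; pose d : R := D.+1%:R; have d_gt0 : 0 < d by rewrite ltr0n.
(* The radius makes the complement of the r-neighbourhood of A small enough
   both for [expander_core] to apply and for a set of density alpha / 2 to
   survive inside A. *)
pose r := Num.bound (24 * d ^+ 2 / (c0 ^+ 2 * alpha) +
  2 * d * (c0 + 4 * d) / (c0 ^+ 2 * alpha ^+ 2)).
pose l := L (2 * r + 1)%N.
(* C1 times the square of the number of vertices will bound the sum of the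
   squares |f x - f y|^2 over the surviving part of A. *)
pose C1 := 16 * d / (c0 / 4) ^+ 2 * (d * l ^+ 2).
have C1_ge0 : 0 <= C1.
  by apply: mulr_ge0; [apply: divr_ge0|apply: mulr_ge0]; rewrite ?sqr_ge0 ?mulr_ge0// ltW.
pose C := 1 + 8 * C1 / alpha ^+ 2.
exists C, (alpha / 4); split; first by rewrite divr_gt0.
move=> X H A f hH [X_conn X_deg X_exp] hA hf.
have X_iso := cheeger_cut X_exp.
have n_gt0 : 0 < #|X|%:R :> R by rewrite ltr0n X_conn.1.
pose n : R := #|X|%:R; rewrite -/n in n_gt0 hA *.
have X_deg1 (x : X) : (#|[set y | adj x y]%SET| <= D.+1)%N.
  by rewrite (leq_trans (X_deg x)).
have adjS := @adj_sym X.
pose Z := ~: thick (@adj X) r A.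
have hZ : c0 * alpha * r%:R * #|Z|%:R <= d * n.
  have := card_thickC adjS c0_gt0 X_deg1 X_iso al_gt0 hA r; rewrite -/Z -/d -/n.
  by have := mulr_ge0 (ltW d_gt0) (ler0n R #|Z|); lra.
have c0r : 24 * d ^+ 2 <= c0 ^+ 2 * alpha * r%:R /\
           2 * d * (c0 + 4 * d) <= c0 ^+ 2 * alpha ^+ 2 * r%:R.
  have p1 : 0 <= 24 * d ^+ 2 / (c0 ^+ 2 * alpha).
    by rewrite !(divr_ge0, mulr_ge0, exprn_ge0)// ltW.
  have p2 : 0 <= 2 * d * (c0 + 4 * d) / (c0 ^+ 2 * alpha ^+ 2).
    by rewrite !(divr_ge0, addr_ge0, mulr_ge0, exprn_ge0)// ltW.
  have := archi_boundP (addr_ge0 p1 p2); rewrite -/r => hr.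
  split; rewrite [leRHS]mulrC -ler_pdivrMr ?mulr_gt0 ?exprn_gt0//; lra.
have Z1 : 24 * d * #|Z|%:R <= c0 * n.
  rewrite -(ler_pM2l d_gt0); have := ler_wpM2r (ler0n R #|Z|) c0r.1.
  have := ler_wpM2l (ltW c0_gt0) hZ; lra.
have Z2 : (c0 + 4 * d) * #|Z|%:R <= c0 * (alpha / 2 * n).
  rewrite -(ler_pM2l d_gt0); have := ler_wpM2r (ler0n R #|Z|) c0r.2.
  have := ler_wpM2l (ltW (mulr_gt0 c0_gt0 al_gt0)) hZ; lra.
have [B [BZ expB hB]] := expander_core adjS c0_gt0 X_deg1 X_iso Z1.
have {}hB : #|~: B|%:R <= alpha / 2 * n.
  by rewrite -(ler_pM2l c0_gt0) (le_trans hB).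
pose A' := A :&: B.
have hA' : alpha / 2 * n <= #|A'|%:R.
  have : #|A|%:R <= #|A'|%:R + #|~: B|%:R :> R.
    rewrite -natrD ler_nat -(cardsID B A) leq_add2l.
    by apply/subset_leq_card/fintype.subsetP => x; rewrite !inE => /andP[].
  lra.
(* The function f \o a on B agrees with f on the points of A and has bounded
   variation along the edges inside B. *)
have /boolp.choice[a aP] : forall x, exists z, x \in B ->
    [/\ z \in A, (graph_dist z x <= r)%N & x \in A -> z = x].
  move=> x.
  have [xA|xA] := boolP (x \in A); first by exists x => _; split; rewrite ?graph_dist0.
  have [xB|xB] := boolP (x \in B); last by exists x.
  have /thick_dist : x \in thick (@adj X) r A.
    by move: xB => /(fintype.subsetP BZ); rewrite finset.setCK.
  by move=> /(_ X_conn)[z zA zx]; exists z.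
have near_adj x y : x \in B -> y \in B -> adj x y -> `|f (a x) - f (a y)| <= l.
  move=> /aP[axA axx _] /aP[ayA ayy _] xy; apply: hf => //.
  rewrite (leq_trans (graph_dist_tri X_conn _ x _))//.
  rewrite mul2n -addnn -addnA leq_add// (leq_trans (graph_dist_tri X_conn x y _))//.
  by rewrite addnC leq_add ?graph_dist_adj// (graph_dist_sym X_conn).
have sumB : \sum_(x in A') \sum_(y in A') `|f x - f y| ^+ 2 <= C1 * n ^+ 2.
  have degB (x : X) : (\sum_(y in B) adj x y <= D.+1)%N by exact: sum_deg.
  have c4_gt0 : 0 < c0 / 4 by rewrite divr_gt0.
  have := hilbert_poincare hH expB c4_gt0 adjS degB (f \o a); rewrite /= -/d.
  set E := (X in _ * X); set S := (X in X <= _ -> _) => hE.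
  have dl_ge0 : 0 <= d * l ^+ 2 by apply: mulr_ge0; rewrite ?sqr_ge0// ltW.
  have E_le : E <= n * (d * l ^+ 2).
    apply: (@le_trans _ _ (\sum_(x in B) d * l ^+ 2)); last first.
      rewrite sumr_const -[_ *+ #|_|]mulr_natl ler_wpM2r//.
      by rewrite ler_nat max_card.
    apply: ler_sum => x xB.
    apply: (@le_trans _ _ ((\sum_(y in B) adj x y)%N%:R * l ^+ 2)); last first.
      by rewrite ler_wpM2r ?sqr_ge0// ler_nat.
    rewrite natr_sum mulr_suml; apply: ler_sum => y yB.
    have [xy|] := boolP (adj x y); last by rewrite !mul0r.
    have h := near_adj x y xB yB xy.
    by rewrite !mul1r lerXn2r ?nnegrE ?normr_ge0// (le_trans (normr_ge0 _) h).
  apply: (@le_trans _ _ S); last first.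
    apply: (le_trans hE).
    rewrite (_ : C1 * n ^+ 2 =
      n * (16 * d / (c0 / 4) ^+ 2) * (n * (d * l ^+ 2))); last first.
      by rewrite /C1; ring.
    apply: ler_pM => //.
    - by rewrite mulr_ge0// divr_ge0 ?sqr_ge0// mulr_ge0// ltW.
    - apply: sumr_ge0 => x _; apply: sumr_ge0 => y _.
      by rewrite mulr_ge0 ?sqr_ge0.
    - rewrite ler_wpM2r ?ler_nat ?max_card//.
      by rewrite divr_ge0 ?sqr_ge0// mulr_ge0// ltW.
  rewrite /S [leRHS](big_setID A') /= (finset.setIidPr (finset.subsetIr A B)).
  rewrite -[leLHS]addr0 lerD//; last first.
    by apply: sumr_ge0 => x _; apply: sumr_ge0 => y _; exact: sqr_ge0.
  apply: ler_sum => x; rewrite inE => /andP[xA xB].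
  rewrite [leRHS](big_setID A') /= (finset.setIidPr (finset.subsetIr A B)).
  rewrite -[leLHS]addr0 lerD//; last by apply: sumr_ge0 => y _; exact: sqr_ge0.
  apply: ler_sum => y; rewrite inE => /andP[yA yB].
  by have [_ _ ->//] := aP x xB; have [_ _ ->//] := aP y yB.
have A'_gt0 : 0 < #|A'|%:R :> R.
  by rewrite (lt_le_trans _ hA')// mulr_gt0// divr_gt0.
have [x xA' hx] : exists2 x, x \in A' &
    \sum_(y in A') `|f x - f y| ^+ 2 <= 2 * C1 / alpha * n.
  apply: contrapT => hno.
  have : \sum_(x in A') (2 * C1 / alpha * n) < \sum_(x in A') \sum_(y in A') `|f x - f y| ^+ 2.
    apply: ltr_sum.
      have : (0 < #|A'|)%N by rewrite -(ltr0n R).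
      by case/card_gt0P => x xA'; apply/hasP; exists x; rewrite ?mem_index_enum.
    move=> x xA'; rewrite ltNge; apply/negP => hx; apply: hno; exists x => //.
  rewrite sumr_const -[_ *+ #|_|]mulr_natl ltNge (le_trans sumB)//.
  rewrite (_ : C1 * n ^+ 2 = alpha / 2 * n * (2 * C1 / alpha * n)); last first.
    by field; rewrite gt_eqF.
  apply: ler_wpM2r => //. have := mulr_ge0 (divr_ge0 C1_ge0 (ltW al_gt0)) (ltW n_gt0). lra.
exists x; first by move: xA'; rewrite inE => /andP[].
have C_ge1 : 1 <= C by rewrite /C lerDl divr_ge0 ?sqr_ge0// mulr_ge0.
have C_gt0 : 0 < C by rewrite (lt_le_trans _ C_ge1).
pose bad := [set y in A' | (C < `|f x - f y|)%R]%SET.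
have bad_le : C * #|bad|%:R <= 2 * C1 / alpha * n.
  apply: le_trans hx; rewrite mulrC mulr_natl -sumr_const.
  have bA : bad \subset A' by apply/fintype.subsetP => y; rewrite inE => /andP[].
  rewrite [leRHS](big_setID bad) /= (finset.setIidPr bA).
  rewrite -[leLHS]addr0 lerD//; last by apply: sumr_ge0 => y _; exact: sqr_ge0.
  apply: ler_sum => y; rewrite inE => /andP[_ hy].
  by rewrite (le_trans (ltW hy))// expr2 ler_peMl// (le_trans C_ge1)// ltW.
have {}bad_le : #|bad|%:R <= alpha / 4 * n.
  rewrite -(ler_pM2l C_gt0) (le_trans bad_le)//.
  rewrite (_ : C * (alpha / 4 * n) = alpha / 4 * n + 2 * C1 / alpha * n).
    by rewrite lerDr mulr_ge0 ?divr_ge0// ltW.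
  by rewrite /C; field; rewrite gt_eqF.
have : #|A'|%:R <= #|bad|%:R + #|[set y in A | (`|f x - f y| <= C)%R]%SET|%:R :> R.
  rewrite -natrD ler_nat; apply: leq_trans (leq_card_setU _ _).
  apply/subset_leq_card/fintype.subsetP => y; rewrite !inE => /andP[-> ->] /=.
  by case: ltP.
lra.
Qed.

(** * Word metrics and coarse embeddings *)

Lemma enum_generators (G : groupType) (S : set G) (k : nat) : (S #= `I_k)%card ->
  exists s : 'I_k -> G, S `<=` range s.
Proof.
move=> /card_set_bijP[f [fk finj fsurj]].
have /boolp.choice[s sP] : forall i : 'I_k, exists g, S g /\ f g = i.
  by move=> i; have [g Sg fg] := fsurj i (ltn_ord i); exists g.
exists s => g Sg; exists (Ordinal (fk g Sg)) => //.
have [Ss fs] := sP (Ordinal (fk g Sg)).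
by apply: finj => //; rewrite ?inE.
Qed.

Lemma pigeonhole (T W : finType) (E : {set T}) (p : T -> W) : (0 < #|E|)%N ->
  exists w, (#|E| <= #|W| * #|[set t in E | p t == w]%SET|)%N.
Proof.
case/card_gt0P => t0 _.
pose n w := #|[set t in E | p t == w]%SET|.
pose w := [arg max_(w > p t0) n w].
have wmax v : (n v <= n w)%N by rewrite /w; case: arg_maxnP => // i _; exact.
exists w; rewrite -/(n w) -sum_nat_const.
apply: (@leq_trans (\sum_v n v)%N); last by apply: leq_sum => v _.
rewrite -sum1_card (partition_big p predT) //=; apply: leq_sum => v _.
rewrite -big_filter /n -sum1_card.
by rewrite big_filter; apply/eq_leq/eq_bigl => t; rewrite inE.
Qed.

(** Words of length at most r in the letters s i (flag true) and their inverses
    (flag false).  The only use of this type is that it is finite, of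
    a cardinality depending on k and r alone. *)
Definition short_word (k r : nat) : finType := {l : 'I_r.+1 & {ffun 'I_l -> 'I_k * bool}}.

Definition eval_word (G : groupType) (k r : nat) (s : 'I_k -> G) (w : short_word k r) : G :=
  (\prod_(i < tag w) (if (tagged w i).2 then s (tagged w i).1 else (s (tagged w i).1)^-1))%g.

Section WordMetric.
Variables (G : groupType) (S : set G) (k : nat) (s : 'I_k -> G).
Hypotheses (S_gen : generates S) (S_enum : S `<=` range s).

Lemma word_dist_eval (x y : G) (r : nat) : (word_dist S x y <= r)%N ->
  exists w : short_word k r, y = (x * eval_word s w)%g.
Proof.
move=> hr; have := leastP (S_gen (x^-1 * y)%g).
rewrite -/(word_length S (x^-1 * y)%g) -/(word_dist S x y) => -[v [vS vE]].
have /boolp.choice[u uP] : forall i, exists p : 'I_k * bool,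
    v i = (if p.2 then s p.1 else (s p.1)^-1)%g.
  move=> i; case: (vS i) => /S_enum[j _ sj]; first by exists (j, true).
  by exists (j, false); rewrite /= sj invgK.
have lt_r : (word_dist S x y < r.+1)%N by rewrite ltnS.
exists (@Tagged _ (Ordinal lt_r) (fun l : 'I_r.+1 => {ffun 'I_l -> 'I_k * bool}) [ffun i => u i]).
rewrite /eval_word /=; apply: (mulgI x^-1%g); rewrite mulKg vE.
by apply: eq_bigr => i _; rewrite ffunE -uP.
Qed.

(** Since a ball of radius r has at most |short_word k r| points, some point has
    a large fibre.  The successor makes the factor visibly positive. *)
Lemma ball_fibre (T : finType) (E : {set T}) (u : T -> G) (x : G) (r : nat) :
    (forall t, t \in E -> (word_dist S x (u t) <= r)%N) ->
  exists y, (#|E| <= #|short_word k r|.+1 * #|[set t in E | `[< u t = y >]]%SET|)%N.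
Proof.
move=> hE; have [E0|E_gt0] := posnP #|E|; first by exists x; rewrite E0.
have [t0 t0E] := card_gt0P E_gt0; have [w0 _] := word_dist_eval (hE t0 t0E).
have /boolp.choice[w wP] : forall t, exists w : short_word k r,
    t \in E -> u t = (x * eval_word s w)%g.
  move=> t; have [/hE/word_dist_eval[w wE]|tE] := boolP (t \in E); first by exists w.
  by exists w0.
have [v vP] := pigeonhole w E_gt0.
exists (x * eval_word s v)%g; apply: (leq_trans vP).
apply: leq_mul; first exact: leqnSn.
apply/subset_leq_card/fintype.subsetP => t; rewrite !inE => /andP[tE /eqP <-].
by rewrite tE; apply/asboolP; exact: wP.
Qed.

End WordMetric.

Section Multiplicative.
Variables (G Q : groupType) (f : {multiplicative G -> Q}).

Lemma multiplicative1 : f 1%g = 1%g.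
Proof. by apply: (mulgI (f 1%g)); rewrite -gmulfM !mulg1. Qed.

Lemma multiplicativeV x : f x^-1%g = (f x)^-1%g.
Proof. by apply: (mulgI (f x)); rewrite -gmulfM !mulgV multiplicative1. Qed.

Lemma is_word_image (S : set G) l g : is_word S l g -> is_word (f @` S) l (f g).
Proof.
move=> [v [vS ->]]; exists (f \o v); split.
  move=> i; case: (vS i) => h; [left|right]; first by exists (v i).
  by exists (v i)^-1%g => //; rewrite multiplicativeV.
exact: (big_morph f (@gmulfM _ _ f) multiplicative1).
Qed.

End Multiplicative.

Lemma word_dist_quotient (G Q : groupType) (S : set G) (pi : {multiplicative G -> Q})
    (x y : G) : generates S ->
  (word_dist (pi @` S) (pi x) (pi y) <= word_dist S x y)%N.
Proof.
move=> S_gen; apply: least_le.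
rewrite /= -multiplicativeV -gmulfM; apply: is_word_image.
exact: leastP (S_gen (x^-1 * y)%g).
Qed.

Lemma quotient_generates (G Q : groupType) (S : set G) (pi : {multiplicative G -> Q}) :
  generates S -> range pi = setT -> generates (pi @` S).
Proof.
move=> S_gen pi_surj q; have [g _ <-] : range pi q by rewrite pi_surj.
by have [l /(is_word_image pi) gl] := S_gen g; exists l.
Qed.

Lemma proper_fun_nat_bound (R : realType) (rho : R -> R) (C : R) : proper_fun rho ->
  exists r : nat, forall m : nat, rho m%:R <= C -> (m <= r)%N.
Proof.
move=> [rho_ge0 rho_bd].
have : bounded_set [set t : R | `|t| <= C].
  by exists C; split; rewrite ?num_real// => M CM t /= /le_trans; apply; exact: ltW.
move=> /rho_bd[M [_ /(_ (M + 1))]]; rewrite ltrDl ltr01 => /(_ isT) MP.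
exists (Num.bound (M + 1)) => m mC.
have := MP m%:R; rewrite /= ler0n ger0_norm ?rho_ge0 ?ler0n// => /(_ (conj isT mC)).
rewrite normr_nat => /le_lt_trans h; rewrite -(ler_nat R) ltW// h//.
have M1_ge0 : 0 <= M + 1.
  have := MP m%:R; rewrite /= ler0n ger0_norm ?rho_ge0 ?ler0n//.
  by move=> /(_ (conj isT mC)); apply: le_trans.
exact: archi_boundP.
Qed.

(** [concentration] pulled back through a coarse embedding into a Hilbert space.
    The upper control gamma is only used at the finitely many integers up to
    Kn * m, so summing its values makes it monotone. *)
Lemma concentrated_ball (R : realType) (D Kn : nat) (c0 alpha : R)
    (Y : nat -> Type) (dY : forall n, Y n -> Y n -> nat) :
    coarsely_embeds_hilbert (fun n (x y : Y n) => (dY n x y)%:R : R) ->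
    0 < c0 -> 0 < alpha ->
  exists (r : nat) (beta : R), 0 < beta /\
    forall n (X : sgraph) (A : {set X}) (u : X -> Y n),
      bounded_expander D c0 X -> alpha * #|X|%:R <= #|A|%:R ->
      (forall x y, x \in A -> y \in A -> (dY n (u x) (u y) <= Kn * graph_dist x y)%N) ->
    exists2 x, x \in A &
      beta * #|X|%:R <= #|[set y in A | (dY n (u x) (u y) <= r)%N]%SET|%:R.
Proof.
move=> [H [hH [phi [rho [gamma [rho_proper gamma_proper phiP]]]]]] c0_gt0 al_gt0.
pose L m := \sum_(j < (Kn * m).+1) gamma j%:R.
have [C [beta [beta_gt0 conc]]] := concentration D L c0_gt0 al_gt0.
have [r rP] := proper_fun_nat_bound C rho_proper.
exists r, beta; split => // n X A u expX hA u_lip.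
have [|x xA hx] := conc X H A (phi n \o u) hH expX hA.
  move=> x y m xA yA xym; have /andP[_ /le_trans] := phiP n (u x) (u y); apply.
  have lt_m : (dY n (u x) (u y) < (Kn * m).+1)%N.
    by rewrite ltnS (leq_trans (u_lip x y xA yA))// leq_mul2l xym orbT.
  rewrite /L (bigD1 (Ordinal lt_m)) //= lerDl; apply: sumr_ge0 => j _.
  exact/gamma_proper.1/ler0n.
exists x => //; rewrite (le_trans hx)// ler_nat.
apply/subset_leq_card/fintype.subsetP => y; rewrite !inE => /andP[-> /= h].
by apply: rP; have /andP[/le_trans + _] := phiP n (u x) (u y); apply.
Qed.

(** * Diameters of expanders and of their dense subsets *)

Lemma geometric_unbounded (R : realType) (q M : R) : 1 < q -> exists a : nat, M <= q ^+ a.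
Proof.
move=> q1; have M_le : M <= Num.max 1 M by rewrite le_max lexx orbT.
pose a := Num.bound (Num.max 1 M / (q - 1)).
have q10 : 0 < q - 1 by rewrite subr_gt0.
have : 0 <= Num.max 1 M / (q - 1).
  by rewrite divr_ge0 ?(ltW q10)// le_max ler01.
move=> /archi_boundP; rewrite -/a ltr_pdivrMr// => ha.
exists a; apply: (le_trans M_le); apply: (le_trans (ltW ha)).
elim: (a) => [|b IH]; first by rewrite mul0r ler01.
rewrite exprS -natr1; have : 1 <= q ^+ b by rewrite exprn_ege1// ltW.
move: (q ^+ b) IH => Q IH Q1; nra.
Qed.

Section Diameter.
Variables (R : realType) (D : nat) (c0 : R) (X : sgraph).
Hypotheses (c0_gt0 : 0 < c0) (expX : bounded_expander D c0 X).
Let q : R := 1 + c0 / D.+1%:R.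

Lemma card_le_diam (A : {set X}) : (#|A| <= D.+1 ^ diam A)%N.
Proof.
have [X_conn X_deg _] := expX.
have [->|[x xA]] := set_0Vmem A; first by rewrite cards0.
apply: leq_trans (card_thick X_deg (diam A) x).
apply/subset_leq_card/fintype.subsetP => y yA.
by apply: dist_thick => //; exact: graph_dist_diam.
Qed.

Lemma ball_growth (x : X) (r : nat) :
  q ^+ r <= #|thick (@adj X) r [set x]%SET|%:R \/
  (#|X| < #|thick (@adj X) r [set x]%SET|.*2)%N.
Proof.
have [X_conn X_deg X_exp] := expX.
elim: r => [|r IH]; first by left; rewrite expr0 cards1.
rewrite /= -/(thick _ r _); move: (thick _ r _) IH => A IH.
have AA : A \subset nbr (@adj X) A by exact: finset.subsetUl.
have [hA|] := ltnP #|X| #|A|.*2.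
  by right; rewrite (leq_trans hA)// leq_double subset_leq_card.
case: IH => [IH hA|h]; last by rewrite leqNgt h.
left; have := cheeger_cut X_exp hA.
have : (cutsize (@adj X) A (~: A))%:R <= D.+1%:R * #|nbr (@adj X) A :\: A|%:R :> R.
  rewrite -natrM ler_nat cut_nbr//; first exact: adj_sym.
  by move=> z; rewrite (leq_trans (X_deg z)).
have -> : #|nbr (@adj X) A|%:R = #|A|%:R + #|nbr (@adj X) A :\: A|%:R :> R.
  by rewrite -natrD -[in LHS](cardsID A) (finset.setIidPr AA).
have d_gt0 : 0 < D.+1%:R :> R by rewrite ltr0n.
move=> h1 /le_trans/(_ h1) h2.
have {}h2 : c0 / D.+1%:R * #|A|%:R <= #|nbr (@adj X) A :\: A|%:R.
  by rewrite mulrAC ler_pdivrMr// [leRHS]mulrC.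
rewrite exprS; apply: (@le_trans _ _ (q * #|A|%:R)).
  by rewrite ler_wpM2l// /q addr_ge0// divr_ge0// ltW.
by rewrite /q mulrDl mul1r lerD2l.
Qed.

(** Two balls that both contain more than half of the vertices meet. *)
Lemma diam_le (s : nat) : #|X|%:R < q ^+ s -> (diam [set: X]%SET <= 2 * s)%N.
Proof.
have [X_conn _ _] := expX; move=> hs.
have half x : (#|X| < #|thick (@adj X) s [set x]%SET|.*2)%N.
  have [h|//] := ball_growth x s.
  have := lt_le_trans hs h; rewrite ltr_nat => h1.
  by have := leq_trans h1 (max_card _); rewrite ltnn.
apply/bigmax_leqP => x _; apply/bigmax_leqP => y _.
set Bx := thick (@adj X) s [set x]%SET; set By := thick (@adj X) s [set y]%SET.
have : (0 < #|Bx :&: By|)%N.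
  have hU : (#|Bx :|: By| <= #|X|)%N by exact: max_card.
  move: hU; have := cardsUI Bx By; have := half x; have := half y; rewrite -/Bx -/By -!addnn; lia.
case/card_gt0P => z; rewrite inE => /andP[/(thick_dist X_conn)[x' + xz]].
rewrite inE => /eqP x'x; move=> /(thick_dist X_conn)[y' + yz].
rewrite inE => /eqP y'y; rewrite x'x in xz; rewrite y'y in yz.
rewrite (leq_trans (graph_dist_tri X_conn x z y))// mul2n -addnn leq_add//.
by rewrite (graph_dist_sym X_conn).
Qed.

End Diameter.

(** Both sides are compared with powers of q = 1 + c0 / D.+1.  With t the diameter
    of A, alpha |X| is at most D.+1 ^+ t, hence at most q ^+ (a * t), so that
    diam X is at most 2 (a t + b).  When X is large, A has more than one vertex
    and t is positive, which absorbs b. *)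
Lemma dense_diam (R : realType) (D : nat) (c0 alpha : R) : 0 < c0 -> 0 < alpha ->
  exists (c : R) (m : nat), 0 < c /\
    forall (X : sgraph) (A : {set X}), bounded_expander D c0 X -> (m <= #|X|)%N ->
      alpha * #|X|%:R <= #|A|%:R ->
    c * (diam [set: X]%SET)%:R <= (diam A)%:R.
Proof.
move=> c0_gt0 al_gt0; pose q : R := 1 + c0 / D.+1%:R.
have q_gt1 : 1 < q by rewrite ltrDl divr_gt0// ltr0n.
have [a ha] := geometric_unbounded D.+1%:R q_gt1.
have [b hb] := geometric_unbounded (2 / alpha) q_gt1.
pose m := Num.bound alpha^-1.
exists (2 * (a + b).+1%:R)^-1, m; split; first by rewrite invr_gt0 mulr_gt0// ltr0n.
move=> X A expX hm hA.
have m_gt : alpha^-1 < m%:R by apply: archi_boundP; rewrite invr_ge0 ltW.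
have aX : 1 < alpha * #|X|%:R.
  rewrite -ltr_pdivrMl// mulr1; apply: (lt_le_trans m_gt).
  by rewrite ler_nat.
have cardA := card_le_diam expX A; set t := diam A in cardA *.
have t_gt0 : (0 < t)%N.
  rewrite lt0n; apply/eqP => t0; move: cardA; rewrite t0 expn0 -(ler_nat R).
  by move=> /(le_trans hA); rewrite leNgt aX.
have : (diam [set: X]%SET <= 2 * (a * t + b))%N.
  apply: (diam_le c0_gt0 expX); rewrite -/q exprD exprM.
  have q_t : alpha * #|X|%:R <= q ^+ a ^+ t.
    apply: (le_trans hA); apply: (@le_trans _ _ (D.+1%:R ^+ t)).
      by rewrite -natrX ler_nat.
    by rewrite lerXn2r ?nnegrE// (le_trans _ ha).
  have X_gt0 : 0 < #|X|%:R :> R by rewrite -(pmulr_rgt0 _ al_gt0) (lt_trans _ aX).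
  apply: (@lt_le_trans _ _ (alpha * #|X|%:R * (2 / alpha))).
    rewrite (_ : _ * (2 / alpha) = #|X|%:R * 2); last by field; rewrite gt_eqF.
    by rewrite ltr_pMr// ltr1n.
  apply: ler_pM => //; first by rewrite mulr_ge0 ?ltW.
  by rewrite divr_ge0// ltW.
move=> hdiam; rewrite mulrC ler_pdivrMr ?mulr_gt0 ?ltr0n//.
rewrite -!natrM ler_nat (leq_trans hdiam)//.
rewrite mulnCA leq_mul2l /= mulnS mulnDr (mulnC a) (leq_trans _ (leq_addl _ _))//.
by rewrite leq_add2l leq_pmull.
Qed.

Theorem proposition2 (R : realType) (k : nat) (N G Q : nat -> groupType)
  (S : forall n, set (G n))
  (iota : forall n, {multiplicative N n -> G n})
  (pi : forall n, {multiplicative G n -> Q n})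
  (S_card : forall n, (S n #= `I_k)%card)
  (S_gen : forall n, generates (S n))
  (exact : forall n, short_exact (iota n) (pi n))
  (embN : coarsely_embeds_hilbert
     (fun n (x y : N n) => (word_dist (S n) (iota n x) (iota n y))%:R : R))
  (embQ : coarsely_embeds_hilbert
     (fun n (x y : Q n) => (word_dist (pi n @` S n) x y)%:R : R))
  (K : R) (K_gt0 : 0 < K)
  (X : nat -> sgraph) (expX : expander R X)
  (h : forall n, X n -> G n)
  (h_lip : forall n (x y : X n),
     (word_dist (S n) (h n x) (h n y))%:R <= K * (graph_dist x y)%:R) :
  exists (c : R) (y : forall n, G n),
    [/\ 0 < c,
        forall n, c * #|X n|%:R <= #|fibre (h n) (y n)|%:R &
        \forall n \near \oo,
          c * (diam [set: X n]%SET)%:R <= (diam (fibre (h n) (y n)))%:R].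
Proof.
have [X_conn [D X_deg] X_infty [c0 c0_gt0 X_exp]] := expX.
have bexpX n : bounded_expander D c0 (X n) by split.
pose Kn := Num.bound K.
have h_lipn n (x y : X n) : (word_dist (S n) (h n x) (h n y) <= Kn * graph_dist x y)%N.
  rewrite -(ler_nat R) natrM (le_trans (h_lip n x y))// ler_wpM2r//.
  by rewrite ltW// archi_boundP// ltW.
have [r1 [b1 [b1_gt0 ball1]]] :=
  concentrated_ball D Kn embQ c0_gt0 (@ltr01 R).
pose M r := #|short_word k r|.+1.
have M_gt0 r : 0 < (M r)%:R :> R by rewrite ltr0n.
pose alpha := b1 / (M r1)%:R.
have alpha_gt0 : 0 < alpha by rewrite divr_gt0.
have coset n : exists q, alpha * #|X n|%:R <= #|[set x | `[< pi n (h n x) = q >]]%SET|%:R.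
  have [s sS] := enum_generators (S_card n).
  have [_ _ pi_surj] := exact n.
  have [||x _ hx] := ball1 n (X n) [set: X n]%SET (pi n \o h n) (bexpX n).
  - by rewrite cardsT mul1r.
  - move=> x y _ _; apply: leq_trans (h_lipn n x y).
    exact: word_dist_quotient.
  have T_enum : pi n @` S n `<=` range (pi n \o s).
    by move=> _ [g /sS[i _ <-] <-]; exists i.
  pose E := [set y in [set: X n]%SET |
    (word_dist (pi n @` S n) (pi n (h n x)) (pi n (h n y)) <= r1)%N]%SET.
  have [|q hq] := ball_fibre (quotient_generates (S_gen n) pi_surj) T_enum
      (E := E) (u := pi n \o h n) (x := pi n (h n x)) (r := r1).
    by move=> y; rewrite inE => /andP[].
  exists q; rewrite mulrAC ler_pdivrMr// [leRHS]mulrC -natrM.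
  rewrite (le_trans hx)// ler_nat (leq_trans hq)// leq_mul2l; apply/orP; right.
  by apply/subset_leq_card/fintype.subsetP => y; rewrite !inE => /andP[_ /asboolP].
have [r2 [b2 [b2_gt0 ball2]]] := @concentrated_ball R D Kn c0 alpha _
  (fun n (x y : N n) => word_dist (S n) (iota n x) (iota n y)) embN c0_gt0 alpha_gt0.
pose beta := b2 / (M r2)%:R.
have beta_gt0 : 0 < beta by rewrite divr_gt0.
have big_fibre n : exists y, beta * #|X n|%:R <= #|fibre (h n) y|%:R.
  have [s sS] := enum_generators (S_card n).
  have [_ iota_pi _] := exact n.
  have [q] := coset n; set A := [set x | _]%SET => hA.
  have [x0 x0A] : exists x0, x0 \in A.
    have A_gt0 : (0 < #|A|)%N.
      rewrite -(ltr0n R) (lt_le_trans _ hA)// mulr_gt0// ltr0n.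
      exact: (X_conn n).1.
    by have [x0] := card_gt0P A_gt0; exists x0.
  have /boolp.choice[nu nuP] : forall x, exists z, x \in A -> iota n z = ((h n x0)^-1 * h n x)%g.
    move=> x; have [xA|xA] := boolP (x \in A); last by exists 1%g.
    have : range (iota n) ((h n x0)^-1 * h n x)%g.
      rewrite iota_pi /= gmulfM multiplicativeV.
      by move: xA x0A; rewrite !inE => -> ->; rewrite mulVg.
    by case=> z _ zE; exists z.
  have distE x y : x \in A -> y \in A ->
      word_dist (S n) (iota n (nu x)) (iota n (nu y)) = word_dist (S n) (h n x) (h n y).
    move=> xA yA; rewrite !nuP// /word_dist invgM invgK.
    by rewrite mulgA mulgK.
  have [|x xA hx] := ball2 n (X n) A nu (bexpX n) hA.
    by move=> x y xA yA; rewrite distE.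
  pose E := [set y in A |
    (word_dist (S n) (iota n (nu x)) (iota n (nu y)) <= r2)%N]%SET.
  have [|y hy] := ball_fibre (S_gen n) sS (E := E) (u := h n) (x := h n x) (r := r2).
    by move=> y; rewrite inE => /andP[yA]; rewrite distE.
  exists y; rewrite mulrAC ler_pdivrMr// [leRHS]mulrC -natrM.
  rewrite (le_trans hx)// ler_nat (leq_trans hy)// leq_mul2l; apply/orP; right.
  by apply/subset_leq_card/fintype.subsetP => z; rewrite !inE => /andP[_ /asboolP].
have [c [m [c_gt0 diamP]]] := dense_diam D c0_gt0 beta_gt0.
pose y n := sval (cid (big_fibre n)).
have yP n : beta * #|X n|%:R <= #|fibre (h n) (y n)|%:R := svalP (cid (big_fibre n)).
exists (Num.min beta c), y; split.
- by rewrite lt_min beta_gt0.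
- move=> n; apply: le_trans (yP n).
  by rewrite ler_wpM2r// ge_min lexx.
- move: X_infty => /cvgnyPge/(_ m); apply: filterS => n hn.
  apply: le_trans (diamP _ _ (bexpX n) hn (yP n)).
  by rewrite ler_wpM2r// ge_min lexx orbT.
Qed.
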